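(* Let $G$ be a multigraph in the class $\mathfrak{SP}'$. Then the reliability polynomial $R_G(q)$ is Schur quasi-stable, i.e. every $q\in\mathbb{C}$ with $R_G(q)=0$ satisfies $|q|\le 1$.
   Context: Multigraphs are finite and may have loops and multiple edges. For a multigraph $G$ and $0\le q\le 1$, let $\mathcal{G}(q)$ be the random spanning subgraph of $G$ obtained by deleting each edge independently with probability $q$; the reliability function $R_G(q)$ is the probability that $\mathcal{G}(q)$ is connected. It is a polynomial in $q$, and it is regarded as a polynomial over $\mathbb{C}$. The class $\mathfrak{SP}$ of series-parallel networks is defined recursively. Each member has a distinguished unordered pair $\{s,t\}$ of distinct vertices, its terminals. A single edge joining its two terminals is in $\mathfrak{SP}$. If $G,G'\in\mathfrak{SP}$ have terminals $\{s,t\}$ and $\{s',t'\}$, no common edges, and only the vertex $t=s'$ in common, then $G\cup G'$ is in $\mathfrak{SP}$ (series connection) with terminals $\{s,t'\}$. If $G,G'\in\mathfrak{SP}$ have no common edges and only the vertices $s=s'$ and $t=t'$ in common, then $G\cup G'$ is in $\mathfrak{SP}$ (parallel connection) with terminals $\{s,t\}$. The class $\mathfrak{SP}'$ consists of the connected multigraphs every two-connected component of which is in $\mathfrak{SP}$ for some choice of terminals. *)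

(* Defs.v *)
From HB Require Import structures.
From mathcomp Require Import all_boot all_order all_algebra.
From mathcomp Require Import reals complex.
Set Implicit Arguments. Unset Strict Implicit. Unset Printing Implicit Defensive.
Import Order.TTheory GRing.Theory Num.Theory.
Local Open Scope ring_scope.

(* A finite multigraph is given by a finite vertex type [V], a finite edge type
   [E] and the endpoint map [ends : E -> V * V] (orientation irrelevant; loops
   [ends e = (v,v)] and multiple edges allowed). Subgraphs are given by edge
   sets [F : {set E}]. *)
Section Multigraph.
Variables (V E : finType) (ends : E -> V * V).

Definition adjF (F : {set E}) : rel V :=
  fun x y => [exists e in F, (ends e == (x, y)) || (ends e == (y, x))].

Definition vertsF (F : {set E}) : {set V} :=
  [set v | [exists e in F, (v == (ends e).1) || (v == (ends e).2)]].

Definition inducedF (W : {set V}) (F : {set E}) : {set E} :=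
  [set e in F | ((ends e).1 \in W) && ((ends e).2 \in W)].

Definition conn_on (W : {set V}) (F : {set E}) : bool :=
  [forall x in W, forall y in W, connect (adjF (inducedF W F)) x y].

Definition spanning_connected (F : {set E}) : bool := conn_on [set: V] F.

(* Reliability polynomial: probability that the random spanning subgraph,
   each edge deleted independently with probability q, is connected. *)
Definition reliability (C : comNzRingType) : {poly C} :=
  \sum_(S : {set E} | spanning_connected S)
     (1 - 'X) ^+ #|S| * 'X ^+ #|~: S|.

Definition nonsep (B : {set E}) : Prop :=
  [/\ B != set0,
      (forall e, e \in B -> (ends e).1 != (ends e).2),
      conn_on (vertsF B) B &
      forall v, v \in vertsF B -> conn_on (vertsF B :\ v) B].

Definition block (B : {set E}) : Prop :=
  nonsep B /\ forall B', nonsep B' -> B \subset B' -> B' = B.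

(* Series-parallel networks, as subgraphs (F, vertsF F) with terminals s t.
   Terminals form an unordered pair (constructor sp_swap). *)
Inductive sp : {set E} -> V -> V -> Prop :=
| sp_edge e s t : s != t -> ends e = (s, t) -> sp [set e] s t
| sp_swap F s t : sp F s t -> sp F t s
| sp_series F1 F2 s m t : sp F1 s m -> sp F2 m t ->
    [disjoint F1 & F2] -> vertsF F1 :&: vertsF F2 = [set m] ->
    sp (F1 :|: F2) s t
| sp_parallel F1 F2 s t : sp F1 s t -> sp F2 s t ->
    [disjoint F1 & F2] -> vertsF F1 :&: vertsF F2 = [set s; t] ->
    sp (F1 :|: F2) s t.

Definition in_SP' : Prop :=
  spanning_connected [set: E] /\
  forall B, block B -> exists s t, sp B s t.

End Multigraph.

(* Main.v *)
(** For a network with terminals [s], [t], let [A] be its reliability and [B] the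
    probability that the random subgraph has exactly two components, separating
    [s] from [t].  Then [A + B] and [B] are multiplicative under parallel
    connection, while series connection gives [A = A1 A2] and
    [B = A1 B2 + B1 A2], so that [B / A] is additive.  For [|q| > 1] a single edge
    satisfies [|A + B| = 1 < |q| = |B|].  The bound [|A + B| < |B|] is preserved by
    parallel connection by multiplicativity, and by series connection because it
    says [Re (B / A) < -1/2].  It forces [A <> 0], and the reliability of a
    connected graph is the product of those of its blocks (a loop contributes the
    factor [1]).  "Connected" is replaced by "[S] connects the endpoints of every
    edge of [F]", which makes sense for every [F] and factors over gluings; such
    factorizations follow from retractions of the vertex set onto one of the parts. *)

Require Import Defs.
From HB Require Import structures.
From mathcomp Require Import all_boot all_order all_algebra.
From mathcomp Require Import reals complex.
From mathcomp Require Import ring.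
Import Order.TTheory GRing.Theory Num.Theory.
Local Open Scope ring_scope.
Set Implicit Arguments.
Unset Strict Implicit.
Unset Printing Implicit Defensive.

(** * Connectivity under retractions and virtual edges *)

Section Retraction.
Variable V : finType.
Implicit Types (r : rel V) (W : {set V}).

Lemma connect_map r r' (h : V -> V) :
  (forall x y, r x y -> connect r' (h x) (h y)) ->
  forall x y, connect r x y -> connect r' (h x) (h y).
Proof.
move=> hr x y /connectP [p]; elim: p x => [|z p IHp] x /=; first by move=> _ ->.
by case/andP=> /hr xz zp ylast; apply: connect_trans xz (IHp _ zp ylast).
Qed.

Lemma connect_stable r W :
  (forall x y, r x y -> x \in W -> y \in W) ->
  forall x y, connect r x y -> x \in W -> y \in W.
Proof.
move=> Wr x y /connectP [p]; elim: p x => [|z p IHp] x /=; first by move=> _ ->.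
by case/andP=> xz zp ylast /(Wr _ _ xz); apply: IHp zp ylast.
Qed.

Definition retr W (m v : V) := if v \in W then v else m.

Lemma retr_in W m v : v \in W -> retr W m v = v.
Proof. by rewrite /retr => ->. Qed.

Lemma retr_cap W W' m v : W :&: W' \subset [set m] -> v \in W' -> retr W m v = m.
Proof.
move=> /subsetP sW vW'; rewrite /retr; case: ifP => // vW.
by apply/set1P/sW; rewrite inE vW.
Qed.

Lemma connect_retr r r' W m x y :
  (forall x y, r x y -> connect r' (retr W m x) (retr W m y)) ->
  x \in W -> y \in W -> connect r x y -> connect r' x y.
Proof. by move=> rr' xW yW /(connect_map rr'); rewrite !retr_in. Qed.

(** A virtual edge between [s] and [t]: it has the effect on connectivity of identifying the two
    vertices, but keeps the vertex type. *)
Definition add_pair r s t : rel V :=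
  fun x y => [|| r x y, (x == s) && (y == t) | (x == t) && (y == s)].

Lemma add_pairC r s t : add_pair r s t =2 add_pair r t s.
Proof. by move=> x y; rewrite /add_pair; congr (_ || _); apply: orbC. Qed.

Lemma add_pair_sym r s t : symmetric r -> symmetric (add_pair r s t).
Proof.
move=> r_sym x y; rewrite /add_pair r_sym; congr (_ || _).
by rewrite orbC andbC [(x == s) && _]andbC.
Qed.

Lemma connect_add_pair r s t x y : connect r x y -> connect (add_pair r s t) x y.
Proof. by apply: connect_sub => u v uv; apply/connect1/orP; left. Qed.

Lemma connect_pair r s t : connect (add_pair r s t) s t.
Proof. by apply: connect1; rewrite /add_pair !eqxx orbT. Qed.

Lemma sub_connect_pair r r' s t : symmetric r' ->
  (forall x y, r x y -> connect r' x y) -> connect r' s t ->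
  forall x y, connect (add_pair r s t) x y -> connect r' x y.
Proof.
move=> /sym_connect_sym r'_sym rr' st; apply: connect_sub => x y.
case/or3P => [/rr' // | | ] /andP[/eqP-> /eqP->] //.
by rewrite r'_sym.
Qed.

End Retraction.

(** * The half-plane condition and its additivity *)

(* [|a + b| < |b|] says that [b / a] lies in the half-plane [Re z < -1/2], which
   is closed under addition. *)
Lemma normD1_lt (C : numClosedFieldType) (x : C) : (`|1 + x| < `|x|) = (1 + x + x^* < 0).
Proof.
rewrite -(@ltr_pXn2r _ 2) ?nnegrE ?normr_ge0 // !normCK -subr_lt0.
by rewrite rmorphD rmorph1 mulrDl mul1r mulrDr mulr1 addrACA addrA addrK addrAC.
Qed.

Lemma series_bound (C : numClosedFieldType) (a1 b1 a2 b2 : C) :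
  `|a1 + b1| < `|b1| -> `|a2 + b2| < `|b2| ->
  `|a1 * a2 + (a1 * b2 + b1 * a2)| < `|a1 * b2 + b1 * a2|.
Proof.
move=> lt1 lt2.
have a1n : a1 != 0 by apply: contraTneq lt1 => ->; rewrite add0r ltxx.
have a2n : a2 != 0 by apply: contraTneq lt2 => ->; rewrite add0r ltxx.
have norm_lt (a b : C) : a != 0 -> `|a + b| < `|b| = (1 + b / a + (b / a)^* < 0).
  move=> an; rewrite -normD1_lt -[RHS](ltr_pM2l (_ : 0 < `|a|)) ?normr_gt0 //.
  by rewrite -!normrM mulrDr mulr1 mulrC divfK.
move: lt1 lt2; rewrite !norm_lt ?mulf_neq0 // => lt1 lt2.
have -> : (a1 * b2 + b1 * a2) / (a1 * a2) = b1 / a1 + b2 / a2.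
  by rewrite addf_div // addrC [a1 * b2]mulrC.
(* With [x] and [y] the two quotients, [1 + (x + y) + (x + y)^*] is the sum of the two negative
   quantities minus [1], hence negative. *)
rewrite rmorphD; have := ltrD lt1 lt2; rewrite addr0; apply: lt_trans.
by rewrite -subr_gt0 (_ : _ - _ = 1) ?ltr01 //; ring.
Qed.

(** * Adjacency and vertex sets of edge sets *)

Section Multigraph.
Variables (V E : finType) (ends : E -> V * V).
Implicit Types (F S B : {set E}) (W : {set V}) (r : rel V) (e : E).
Local Notation adj := (adjF ends).
Local Notation verts := (vertsF ends).

Lemma adjP F x y :
  reflect (exists2 e, e \in F & ends e = (x, y) \/ ends e = (y, x)) (adj F x y).
Proof.
apply: (iffP exists_inP) => -[e eF exy]; exists e => //.
  by case/orP: exy => /eqP; [left | right].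
by case: exy => ->; rewrite eqxx ?orbT.
Qed.

Lemma adj_sym F : symmetric (adj F).
Proof. by move=> x y; apply/adjP/adjP => -[e eF [] ?]; exists e => //; auto. Qed.

Lemma connect_adjC F x y : connect (adj F) x y = connect (adj F) y x.
Proof. exact/sym_connect_sym/adj_sym. Qed.

Lemma adj_ends F e : e \in F -> adj F (ends e).1 (ends e).2.
Proof. by move=> eF; apply/adjP; exists e => //; left; case: (ends e). Qed.

Lemma adjU F1 F2 x y : adj (F1 :|: F2) x y = adj F1 x y || adj F2 x y.
Proof.
apply/adjP/orP => [[e]|].
  by rewrite inE => /orP[] eF exy; [left | right]; apply/adjP; exists e.
by case=> /adjP [e eF exy]; exists e => //; rewrite inE eF ?orbT.
Qed.

Lemma connect_adjS S F x y : S \subset F -> connect (adj S) x y -> connect (adj F) x y.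
Proof.
move=> /subsetP sSF; apply: connect_sub => u v /adjP [e eS euv].
by apply/connect1/adjP; exists e => //; apply: sSF.
Qed.

Lemma vertsP F v :
  reflect (exists2 e, e \in F & v = (ends e).1 \/ v = (ends e).2) (v \in verts F).
Proof.
rewrite inE; apply: (iffP exists_inP) => -[e eF ev]; exists e => //.
  by case/orP: ev => /eqP; [left | right].
by case: ev => ->; rewrite eqxx ?orbT.
Qed.

Lemma vertsS S F : S \subset F -> verts S \subset verts F.
Proof.
move=> /subsetP sSF; apply/subsetP => v /vertsP [e eS ev].
by apply/vertsP; exists e => //; apply: sSF.
Qed.

Lemma ends1_verts F e : e \in F -> (ends e).1 \in verts F.
Proof. by move=> eF; apply/vertsP; exists e => //; left. Qed.

Lemma ends2_verts F e : e \in F -> (ends e).2 \in verts F.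
Proof. by move=> eF; apply/vertsP; exists e => //; right. Qed.

Lemma vertsU F1 F2 : verts (F1 :|: F2) = verts F1 :|: verts F2.
Proof.
apply/setP => v; rewrite in_setU; apply/vertsP/orP => [[e]|].
  by rewrite inE => /orP[] eF ev; [left | right]; apply/vertsP; exists e.
by case=> /vertsP [e eF ev]; exists e => //; rewrite inE eF ?orbT.
Qed.

Lemma adj_verts S F x y : S \subset F -> adj S x y -> (x \in verts F) && (y \in verts F).
Proof.
move=> /vertsS /subsetP sSF /adjP [e eS exy].
move: (sSF _ (ends1_verts eS)) (sSF _ (ends2_verts eS)).
by case: exy => -> /= -> ->.
Qed.

Lemma connect_verts S F x y : S \subset F -> connect (adj S) x y ->
  x = y \/ y \in verts F.
Proof.
move=> sSF; rewrite connect_adjC => /connectP [[|z p] /=]; first by left.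
by case/andP=> /(adj_verts sSF)/andP[]; right.
Qed.

(** * Spanning an edge set, outright or up to a pair of terminals *)

Definition spans r F := [forall e in F, connect r (ends e).1 (ends e).2].

Lemma spansP r F :
  reflect (forall e, e \in F -> connect r (ends e).1 (ends e).2) (spans r F).
Proof. exact: forall_inP. Qed.

Lemma spans_connect r F x y : symmetric r -> spans r F ->
  connect (adj F) x y -> connect r x y.
Proof.
move=> /sym_connect_sym r_sym /spansP rF; apply: connect_sub => u v.
by case/adjP => e /rF euv [] exy; rewrite exy in euv => //; rewrite r_sym.
Qed.

Lemma spansU r F1 F2 : spans r (F1 :|: F2) = spans r F1 && spans r F2.
Proof.
apply/spansP/andP => [rF | [/spansP rF1 /spansP rF2] e].
  by split; apply/spansP => e eF; apply: rF; rewrite inE eF ?orbT.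
by case/setUP => [/rF1|/rF2].
Qed.

Lemma spans_sub r r' F : (forall x y, connect r x y -> connect r' x y) ->
  spans r F -> spans r' F.
Proof. by move=> rr' /spansP rF; apply/spansP => e /rF/rr'. Qed.

Lemma spans_retr r r' F m :
  (forall x y, r x y -> connect r' (retr (verts F) m x) (retr (verts F) m y)) ->
  spans r F -> spans r' F.
Proof.
move=> rr' /spansP rF; apply/spansP => e eF.
by apply: (connect_retr rr') (rF e eF); rewrite ?ends1_verts ?ends2_verts.
Qed.

(** The event of weight [A + B]: [S] spans [F] once [s] and [t] are joined by a virtual edge. *)
Definition spans2 S F s t := spans (add_pair (adj S) s t) F.

(* For connected [F]: [S] has exactly two components on the vertices of [F], and
   they separate [s] from [t]. *)
Definition splits S F s t := spans2 S F s t && ~~ connect (adj S) s t.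

Lemma spans2C S F s t : spans2 S F s t = spans2 S F t s.
Proof.
by apply: eq_forallb_in => e _; apply/eq_connect/add_pairC.
Qed.

Lemma splitsC S F s t : splits S F s t = splits S F t s.
Proof. by rewrite /splits spans2C connect_adjC. Qed.

Lemma spans2_connect S F s t : connect (adj S) s t ->
  spans2 S F s t = spans (adj S) F.
Proof.
move=> st; apply/idP/idP; apply: spans_sub => x y; last exact: connect_add_pair.
by apply: sub_connect_pair => //; [exact: adj_sym | exact: connect1].
Qed.

(** Since [F] joins [s] to [t], so does every [S] spanning [F]; this makes the two outcomes
    exclusive. The form is that of the hypothesis of [Z_or]. *)
Lemma spans_and_splits S F s t : connect (adj F) s t ->
  spans2 S F s t = spans (adj S) F || splits S F s t /\
  ~~ (spans (adj S) F && splits S F s t).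
Proof.
move=> Fst; rewrite /splits; have [st|nst] := boolP (connect (adj S) s t).
  by rewrite (spans2_connect _ st) andbF orbF andbF.
have nS: spans (adj S) F = false.
  by apply: contraNF nst => /spans_connect; apply => //; apply: adj_sym.
by rewrite nS andbT.
Qed.

(** * Gluing at no more than one vertex *)

Section OneVertex.
Variables (F1 F2 : {set E}) (m : V).
Hypothesis cap : verts F1 :&: verts F2 \subset [set m].
Variables S1 S2 : {set E}.
Hypotheses (sS1 : S1 \subset F1) (sS2 : S2 \subset F2).

Lemma retr_adjU x y : adj (S1 :|: S2) x y ->
  connect (adj S1) (retr (verts F1) m x) (retr (verts F1) m y).
Proof.
rewrite adjU => /orP[xy|/(adj_verts sS2)/andP[xV yV]].
  by have /andP[xV yV] := adj_verts sS1 xy; rewrite !retr_in // connect1.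
by rewrite !(retr_cap cap).
Qed.

Lemma spans_glue_l : spans (adj (S1 :|: S2)) F1 = spans (adj S1) F1.
Proof.
apply/idP/idP; first exact/spans_retr/retr_adjU.
by apply: spans_sub => x y; apply/connect_adjS/subsetUl.
Qed.

End OneVertex.

Lemma spans_glue F1 F2 m S1 S2 : verts F1 :&: verts F2 \subset [set m] ->
  S1 \subset F1 -> S2 \subset F2 ->
  spans (adj (S1 :|: S2)) (F1 :|: F2) = spans (adj S1) F1 && spans (adj S2) F2.
Proof.
move=> cap sS1 sS2; rewrite spansU (spans_glue_l cap) //.
by rewrite setUC (@spans_glue_l F2 F1 m) // setIC.
Qed.

(** * Series connection *)

Section Series.
Variables (F1 F2 : {set E}) (s m t : V).
Hypothesis cap : verts F1 :&: verts F2 = [set m].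
Hypotheses (sV : s \in verts F1) (tV : t \in verts F2).
Variables S1 S2 : {set E}.
Hypotheses (sS1 : S1 \subset F1) (sS2 : S2 \subset F2).

Let cap12 : verts F1 :&: verts F2 \subset [set m].
Proof. by rewrite cap. Qed.

Let cap21 : verts F2 :&: verts F1 \subset [set m].
Proof. by rewrite setIC cap. Qed.

Let retr_adjU_r x y : adj (S1 :|: S2) x y ->
  connect (adj S2) (retr (verts F2) m x) (retr (verts F2) m y).
Proof. by rewrite setUC; apply: (retr_adjU cap21). Qed.

Lemma series_connect :
  connect (adj (S1 :|: S2)) s t = connect (adj S1) s m && connect (adj S2) m t.
Proof.
apply/idP/andP => [st | [sm mt]].
  have := connect_map (retr_adjU cap12 sS1 sS2) st.
  have := connect_map retr_adjU_r st.
  by rewrite (retr_in _ sV) (retr_in _ tV) (retr_cap cap12 tV) (retr_cap cap21 sV).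
apply: connect_trans (connect_adjS (subsetUl _ _) sm) _.
exact: connect_adjS (subsetUr _ _) mt.
Qed.

(** Retracting onto [F1] turns the virtual edge [s t] into [s m]; retracting onto [F2] turns it into
    [m t], already joined by [S2]. Conversely, [s] reaches [m] by the virtual edge to [t] and then
    through [S2]. *)
Lemma series_spans2_l : connect (adj S2) m t ->
  spans2 (S1 :|: S2) (F1 :|: F2) s t = spans2 S1 F1 s m && spans (adj S2) F2.
Proof.
move=> mt; rewrite /spans2 spansU; congr (_ && _); apply/idP/idP.
- apply: (@spans_retr _ _ _ m) => x y.
  have sm : connect (add_pair (adj S1) s m) s m := connect_pair _ _ _.
  have r_sym := sym_connect_sym (add_pair_sym s m (@adj_sym S1)).
  case/or3P => [xy | /andP[/eqP-> /eqP->] | /andP[/eqP-> /eqP->]].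
  + exact: connect_add_pair (retr_adjU cap12 sS1 sS2 xy).
  + by rewrite (retr_in _ sV) (retr_cap cap12 tV).
  + by rewrite (retr_in _ sV) (retr_cap cap12 tV) r_sym.
- apply: spans_sub; apply: sub_connect_pair; first exact/add_pair_sym/adj_sym.
    by move=> x y xy; apply/connect_add_pair/(connect_adjS (subsetUl _ _))/connect1.
  apply: connect_trans (connect_pair _ _ _) _; apply/connect_add_pair.
  by rewrite connect_adjC; apply: connect_adjS mt; apply: subsetUr.
- apply: (@spans_retr _ _ _ m) => x y.
  case/or3P => [/retr_adjU_r // | /andP[/eqP-> /eqP->] | /andP[/eqP-> /eqP->]].
    by rewrite (retr_in _ tV) (retr_cap cap21 sV).
  by rewrite (retr_in _ tV) (retr_cap cap21 sV) connect_adjC.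
- apply: spans_sub => x y xy.
  by apply: connect_add_pair; apply: connect_adjS xy; apply: subsetUr.
Qed.

Lemma series_disconnected : s != m -> t != m -> connect (adj F1) s m ->
  ~~ connect (adj S1) s m -> ~~ connect (adj S2) m t ->
  ~~ spans2 (S1 :|: S2) (F1 :|: F2) s t.
Proof.
move=> sm tm F1c n1 n2.
(* The component of [m]. It misses [s] and [t], so the virtual edge does not leave it, whereas
   spanning would link [m] to [s]. *)
pose W := [set v | connect (adj S1) m v || connect (adj S2) m v].
have n1' : ~~ connect (adj S1) m s by rewrite connect_adjC.
have sW : s \notin W.
  rewrite inE (negPf n1') /=; apply: contra sm => /(connect_verts sS2)[-> // | sV2].
  by rewrite -in_set1 -cap inE sV.
have tW : t \notin W.
  rewrite inE (negPf n2) orbF; apply: contra tm => /(connect_verts sS1)[-> // | tV1].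
  by rewrite -in_set1 -cap inE tV1.
apply/negP => spF; apply: (negP sW).
have mW : m \in W by rewrite inE connect0.
have Fms : connect (adj (F1 :|: F2)) m s.
  by rewrite connect_adjC; apply: connect_adjS F1c; apply: subsetUl.
have rms := spans_connect (add_pair_sym s t (@adj_sym _)) spF Fms.
apply: connect_stable rms mW => x y.
(* A vertex of [G] reached from [m] through the other part is shared, hence is [m] itself. Stated
   for generic parts so that it serves both orders. *)
have cl_l S S' (G G' : {set E}) : S \subset G -> S' \subset G' ->
  verts G :&: verts G' \subset [set m] -> forall u v, adj S u v ->
  connect (adj S) m u || connect (adj S') m u -> connect (adj S) m v.
- move=> sSG sSG' capG u v uv mu.
  have /andP[uG _] := adj_verts sSG uv.
  have {}mu : connect (adj S) m u.
    case/orP: mu => // /(connect_verts sSG')[<- | uG']; first exact: connect0.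
    have: u \in [set m] by apply: (subsetP capG); rewrite inE uG.
    by move/set1P->; apply: connect0.
  exact: connect_trans mu (connect1 uv).
case/or3P => [| /andP[/eqP-> _] | /andP[/eqP-> _]]; last 2 first.
- by move/negPf: sW => ->.
- by move/negPf: tW => ->.
rewrite adjU !inE => /orP[] xy.
  by move=> /(cl_l _ _ _ _ sS1 sS2 cap12 _ _ xy)->.
by rewrite orbC => /(cl_l _ _ _ _ sS2 sS1 cap21 _ _ xy)->; rewrite orbT.
Qed.

End Series.

(** Case analysis on which of the pairs [s m] and [m t] are joined. If [S2] joins its pair, or by
    symmetry [S1] does, [series_spans2_l] applies; if neither does, there are too many components
    and both sides are false. *)
Lemma series_splits F1 F2 s m t S1 S2 : verts F1 :&: verts F2 = [set m] ->
  s \in verts F1 -> t \in verts F2 -> s != m -> t != m ->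
  connect (adj F1) s m -> connect (adj F2) m t ->
  S1 \subset F1 -> S2 \subset F2 ->
  splits (S1 :|: S2) (F1 :|: F2) s t =
  spans (adj S1) F1 && splits S2 F2 m t || splits S1 F1 s m && spans (adj S2) F2.
Proof.
move=> cap sV tV sm tm F1c F2c sS1 sS2.
have cap' : verts F2 :&: verts F1 = [set m] by rewrite setIC.
rewrite {1}/splits (series_connect cap) //.
have [c2|n2] := boolP (connect (adj S2) m t).
  rewrite (series_spans2_l cap) // /splits c2 !andbF andbT.
  by rewrite -andbA [_ && ~~ _]andbC andbA.
have n2F : spans (adj S2) F2 = false.
  by apply: contraNF n2 => /spans_connect; apply => //; apply: adj_sym.
have [c1|n1] := boolP (connect (adj S1) s m).
  rewrite n2F !andbF orbF /splits n2 !andbT.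
  have c1' : connect (adj S1) m s by rewrite connect_adjC.
  by rewrite spans2C setUC (setUC F1) (series_spans2_l cap') // spans2C andbC.
have n1F : spans (adj S1) F1 = false.
  by apply: contraNF n1 => /spans_connect; apply => //; apply: adj_sym.
have n12 := series_disconnected cap sV tV sS1 sS2 sm tm F1c n1 n2.
by rewrite n1F n2F !andbF (negPf n12).
Qed.

(** * Parallel connection *)

Section Parallel.
Variables (F1 F2 : {set E}) (s t : V).
Hypothesis cap : verts F1 :&: verts F2 = [set s; t].
Variables S1 S2 : {set E}.
Hypotheses (sS1 : S1 \subset F1) (sS2 : S2 \subset F2).

(** Retract onto [F1] with default value [s]: vertices of [F2] land on [s] or [t], which the virtual
    edge joins, so the edges of [S2] add nothing. *)
Lemma parallel_spans2_l : spans2 (S1 :|: S2) F1 s t = spans2 S1 F1 s t.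
Proof.
have r_sym := sym_connect_sym (add_pair_sym s t (@adj_sym S1)).
have st : connect (add_pair (adj S1) s t) s t := connect_pair _ _ _.
have /andP[sV1 tV1] : (s \in verts F1) && (t \in verts F1).
  move/setP: cap => cap'; have := cap' s; have := cap' t.
  by rewrite !inE !eqxx orbT => /andP[-> _] /andP[-> _].
apply/idP/idP.
  apply: (@spans_retr _ _ _ s) => x y; rewrite /add_pair adjU -orbA.
  case/or4P => [xy | /(adj_verts sS2)/andP[xV yV]
               | /andP[/eqP-> /eqP->] | /andP[/eqP-> /eqP->]].
  - have /andP[xV yV] := adj_verts sS1 xy.
    by rewrite !retr_in //; apply/connect_add_pair/connect1.
  - have r2 v : v \in verts F2 ->
      connect (add_pair (adj S1) s t) s (retr (verts F1) s v).
      move=> vV; rewrite /retr; case: ifP => // vV1.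
      have: v \in [set s; t] by rewrite -cap inE vV1.
      by case/set2P => ->.
    by apply: connect_trans (r2 _ yV); rewrite r_sym r2.
  - by rewrite !retr_in.
  - by rewrite !retr_in // r_sym.
apply: spans_sub; apply: sub_connect_pair (connect_pair _ _ _).
  exact/add_pair_sym/adj_sym.
by move=> x y xy; apply/connect_add_pair/(connect_adjS (subsetUl _ _))/connect1.
Qed.

Lemma parallel_connect : s != t ->
  connect (adj (S1 :|: S2)) s t = connect (adj S1) s t || connect (adj S2) s t.
Proof.
move=> st; apply/idP/orP => [|[]]; last 2 first.
- exact/connect_adjS/subsetUl.
- exact/connect_adjS/subsetUr.
move=> cst; apply/orP; apply: contraT; rewrite negb_or => /andP[n1 n2].
pose W := [set v | connect (adj S1) s v || connect (adj S2) s v].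
suff: t \in W by rewrite inE (negPf n1) (negPf n2).
apply: (connect_stable (W := W) _ cst); last by rewrite inE connect0.
move=> x y.
(* A walk from [s] can change parts only at [s] or [t], and [t] is not reached within either
   part. *)
have cl S S' (G G' : {set E}) : S \subset G -> S' \subset G' ->
  verts G :&: verts G' = [set s; t] -> ~~ connect (adj S') s t ->
  forall u v, adj S u v ->
  connect (adj S) s u || connect (adj S') s u -> connect (adj S) s v.
- move=> sSG sSG' capG n u v uv su.
  have /andP[uG _] := adj_verts sSG uv.
  have {}su : connect (adj S) s u.
    case/orP: su => // su; have [<- | uG'] := connect_verts sSG' su.
      exact: connect0.
    have: u \in [set s; t] by rewrite -capG inE uG.
    by case/set2P => eu; [rewrite eu connect0 | rewrite eu (negPf n) in su].
  exact: connect_trans su (connect1 uv).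
rewrite adjU !inE => /orP[] xy.
  by move=> /(cl _ _ _ _ sS1 sS2 cap n2 _ _ xy)->.
have cap' : verts F2 :&: verts F1 = [set s; t] by rewrite setIC.
by rewrite orbC => /(cl _ _ _ _ sS2 sS1 cap' n1 _ _ xy)->; rewrite orbT.
Qed.

End Parallel.

Lemma parallel_spans2 F1 F2 s t S1 S2 : verts F1 :&: verts F2 = [set s; t] ->
  S1 \subset F1 -> S2 \subset F2 ->
  spans2 (S1 :|: S2) (F1 :|: F2) s t = spans2 S1 F1 s t && spans2 S2 F2 s t.
Proof.
move=> cap sS1 sS2; rewrite {1}/spans2 spansU.
congr (_ && _); first exact: parallel_spans2_l cap _ _ sS1 sS2.
by rewrite setUC; apply: parallel_spans2_l sS2 sS1; rewrite setIC.
Qed.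

Lemma parallel_splits F1 F2 s t S1 S2 : s != t ->
  verts F1 :&: verts F2 = [set s; t] -> S1 \subset F1 -> S2 \subset F2 ->
  splits (S1 :|: S2) (F1 :|: F2) s t = splits S1 F1 s t && splits S2 F2 s t.
Proof.
move=> st cap sS1 sS2.
by rewrite /splits (parallel_connect cap) // (parallel_spans2 cap) // negb_or andbACA.
Qed.

(** * Nonseparable edge sets and splitting at a vertex *)

Lemma induced_adjP W F x y : adj (inducedF ends W F) x y ->
  [/\ x \in W, y \in W & adj F x y].
Proof.
case/adjP => e; rewrite inE => /and3P[eF e1 e2] exy.
have xy : adj F x y by apply/adjP; exists e.
by case: exy e1 e2 => -> /=.
Qed.

Lemma adj_induced W F e : e \in F -> (ends e).1 \in W -> (ends e).2 \in W ->
  adj (inducedF ends W F) (ends e).1 (ends e).2.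
Proof. by move=> eF e1 e2; apply: adj_ends; rewrite inE eF e1 e2. Qed.

Lemma conn_onP W F : reflect
  (forall x y, x \in W -> y \in W -> connect (adj (inducedF ends W F)) x y)
  (conn_on ends W F).
Proof.
apply: (iffP forall_inP) => WF x => [y xW|xW]; first exact/forall_inP/WF.
by apply/forall_inP => y; apply: WF.
Qed.

(** Removing [m] leaves [B] connected, and a walk avoiding [m] cannot pass from [F1] to [F2]. As [B]
    has no loops, each of its edges keeps an endpoint other than [m]. *)
Lemma nonsep_side F1 F2 m B : verts F1 :&: verts F2 \subset [set m] ->
  nonsep ends B -> B \subset F1 :|: F2 -> B :&: F1 != set0 -> B \subset F1.
Proof.
move=> cap [_ noloop conB cutB] sBF /set0Pn[e1 /setIP[e1B e1F]].
have shared v : v \in verts F1 -> v \in verts F2 -> v = m.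
  by move=> v1 v2; apply/set1P/(subsetP cap); rewrite inE v1.
have away e : e \in B ->
    exists2 v, v \in verts B :\ m & v = (ends e).1 \/ v = (ends e).2.
  move=> eB; have [e_m | e_m] := eqVneq (ends e).1 m.
    exists (ends e).2; last by right.
    by rewrite in_setD1 ends2_verts // -e_m eq_sym noloop.
  by exists (ends e).1; [rewrite in_setD1 e_m ends1_verts | left].
have conn : conn_on ends (verts B :\ m) B.
  have [mB|mB] := boolP (m \in verts B); first exact: cutB.
  suff -> : verts B :\ m = verts B by [].
  by apply/setP => v; rewrite in_setD1; case: eqP => //= ->; rewrite (negPf mB).
have [x xW xe] := away _ e1B.
have x1 : x \in verts F1 by case: xe => ->; rewrite ?ends1_verts ?ends2_verts.
apply/subsetP => e eB; have /setUP[// | eF2] := subsetP sBF _ eB.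
have [y yW ye] := away _ eB.
have y2 : y \in verts F2 by case: ye => ->; rewrite ?ends1_verts ?ends2_verts.
(* Reaching [y] within [F1] would make it a shared vertex, that is [m], which was removed. *)
suff y1 : y \in verts F1 by move: yW; rewrite (shared _ y1 y2) in_setD1 eqxx.
apply: connect_stable (conn_onP _ _ conn _ _ xW yW) x1 => u v.
case/induced_adjP; rewrite in_setD1 => /andP[um _] _ uv u1.
have uvF : adj (F1 :|: F2) u v.
  case/adjP: uv => e' e'B euv.
  by apply/adjP; exists e' => //; apply: (subsetP sBF).
move: uvF; rewrite adjU => /orP[/(adj_verts (subxx _))/andP[] //|].
case/(adj_verts (subxx _))/andP => u2 _.
by rewrite (shared _ u1 u2) eqxx in um.
Qed.

(** Used with [W] all vertices of [F], when [F] is disconnected, and with one vertex removed, when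
    that vertex is a cut vertex. *)
Lemma split_disconnected W F : W \subset verts F -> ~~ conn_on ends W F ->
  exists F1 F2, [/\ F1 :|: F2 = F, [disjoint F1 & F2], F1 != set0, F2 != set0 &
    verts F1 :&: verts F2 \subset ~: W].
Proof.
move=> /subsetP sWF; rewrite negb_forall_in => /exists_inP[x xW].
rewrite negb_forall_in => /exists_inP[y yW nxy].
pose c := connect (adj (inducedF ends W F)) x.
(* The edges touching the component of [x] within [W]. An edge with both ends in [W] has them in the
   same component, so any endpoint in [W] decides membership. *)
pose F1 := [set e in F |
  ((ends e).1 \in W) && c (ends e).1 || ((ends e).2 \in W) && c (ends e).2].
have F1P e u : e \in F -> u \in W -> u = (ends e).1 \/ u = (ends e).2 ->
    (e \in F1) = c u.
  move=> eF uW ue; rewrite inE eF /=; apply/idP/idP; last first.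
    by case: ue => <-; rewrite uW => ->; rewrite ?orbT.
  have cE : (ends e).1 \in W -> (ends e).2 \in W -> c (ends e).1 = c (ends e).2.
    move=> e1 e2; have e12 := connect1 (adj_induced eF e1 e2).
    apply/idP/idP => xc; first exact: connect_trans xc e12.
    by apply: connect_trans xc _; rewrite connect_adjC.
  by case/orP => /andP[vW]; case: ue => eu; rewrite eu // in uW *; rewrite cE.
have sF1 : F1 \subset F by apply/subsetP => e; rewrite inE => /andP[].
exists F1, (F :\: F1).
split.
- by rewrite -{1}(setIidPr sF1) setID.
- by rewrite disjoint_sym disjoints_subset setDE subsetIr.
- have /vertsP[e eF xe] := sWF _ xW; apply/set0Pn; exists e.
  by rewrite (F1P _ _ eF xW xe) /c connect0.
- have /vertsP[e eF ye] := sWF _ yW; apply/set0Pn; exists e.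
  by rewrite in_setD eF (F1P _ _ eF yW ye) nxy.
apply/subsetP => v /setIP[/vertsP[e1 e1F ve1] /vertsP[e2]].
rewrite in_setD => /andP[e2n e2F] ve2; rewrite inE; apply: contra e2n => vW.
by rewrite (F1P _ _ e2F vW ve2) -(F1P _ _ (subsetP sF1 _ e1F) vW ve1).
Qed.

Lemma nonsep_or_split F : F != set0 -> (forall e, e \in F -> (ends e).1 != (ends e).2) ->
  nonsep ends F \/ exists F1 F2 m, [/\ F1 :|: F2 = F, [disjoint F1 & F2],
    F1 != set0, F2 != set0 & verts F1 :&: verts F2 \subset [set m]].
Proof.
move=> Fn noloop.
have [con|/(split_disconnected (subxx _))[F1 [F2 [<- dF n1 n2 cap]]]] :=
    boolP (conn_on ends (verts F) F); last first.
  (* The two parts share no vertex here, so any vertex serves as [m]. *)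
  right; have /set0Pn[e _] := Fn; exists F1, F2, (ends e).1; split=> //.
  apply: subset_trans (sub0set _).
  rewrite -(setICr (verts (F1 :|: F2))) subsetI cap andbT.
  by rewrite vertsU; apply: subset_trans (subsetIl _ _) (subsetUl _ _).
have [/forall_inP cut|] := boolP [forall v in verts F, conn_on ends (verts F :\ v) F].
  by left.
rewrite negb_forall_in => /exists_inP[v _].
case/(split_disconnected (subsetDl _ _)) => F1 [F2 [E12 dF n1 n2 cap]].
right; exists F1, F2, v; split=> //; apply/subsetP => u u12.
have := subsetP cap _ u12; rewrite !inE negb_and negbK.
case/orP => // uF; have : u \in verts F.
  by rewrite -E12 vertsU in_setU; case/setIP: u12 => ->.
by rewrite inE (negPf uF).
Qed.

(** * Weighted sums over edge subsets *)

Section Weight.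
Variables (C : numClosedFieldType) (q : C).

Definition weight F S : C := (1 - q) ^+ #|S| * q ^+ #|F :\: S|.

(** For real [q] between 0 and 1, the probability that [P] holds for the random subset of [F]; for
    complex [q], the value of the same polynomial. *)
Definition Z F (P : pred {set E}) : C :=
  \sum_(S : {set E} | (S \subset F) && P S) weight F S.

Lemma eq_Z F (P P' : pred {set E}) : (forall S, S \subset F -> P S = P' S) ->
  Z F P = Z F P'.
Proof. by move=> PP'; apply: eq_bigl => S; case: (boolP (_ \subset _)) => // /PP'. Qed.

Lemma Z_or F (P P1 P2 : pred {set E}) :
  (forall S, S \subset F -> P S = P1 S || P2 S /\ ~~ (P1 S && P2 S)) ->
  Z F P = Z F P1 + Z F P2.
Proof.
move=> PP; rewrite /Z !big_mkcondr -big_split; apply: eq_bigr => S /PP[-> /=].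
by case: (P1 S) (P2 S) => [] [] //=; rewrite ?addr0 ?add0r.
Qed.

Lemma weightU F1 F2 S1 S2 : [disjoint F1 & F2] -> S1 \subset F1 -> S2 \subset F2 ->
  weight (F1 :|: F2) (S1 :|: S2) = weight F1 S1 * weight F2 S2.
Proof.
move=> dF sS1 sS2; have dS : [disjoint S1 & S2].
  by apply: disjointWl sS1 _; apply: disjointWr sS2 dF.
have dD : [disjoint F1 :\: S1 & F2 :\: S2].
  by apply: disjointWl (subsetDl _ _) _; apply: disjointWr (subsetDl _ _) dF.
rewrite /weight.
have -> : (F1 :|: F2) :\: (S1 :|: S2) = (F1 :\: S1) :|: (F2 :\: S2).
  apply/setP => e; rewrite !inE.
  have n12 : ~~ ((e \in F1) && (e \in F2)) by rewrite -in_setI disjoint_setI0 ?inE.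
  have s1 : (e \in S1) ==> (e \in F1) by apply/implyP/(subsetP sS1).
  have s2 : (e \in S2) ==> (e \in F2) by apply/implyP/(subsetP sS2).
  by move: n12 s1 s2; do 4!case: (e \in _).
by rewrite !cardsU !disjoint_setI0 // cards0 !subn0 !exprD mulrACA.
Qed.

Lemma setUI_disjoint F1 F2 S1 S2 : [disjoint F1 & F2] ->
  S1 \subset F1 -> S2 \subset F2 ->
  (S1 :|: S2) :&: F1 = S1 /\ (S1 :|: S2) :&: F2 = S2.
Proof.
move=> dF sS1 sS2; rewrite !setIUl (setIidPl sS1) (setIidPl sS2).
rewrite (disjoint_setI0 (disjointWl sS1 dF)) set0U disjoint_setI0 ?setU0 //.
by apply: disjointWl sS2 _; rewrite disjoint_sym.
Qed.

(** Independence: a subset of the union corresponds to the pair of its traces on [F1] and [F2], and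
    weights multiply. *)
Lemma Z_disjointU F1 F2 (P P1 P2 : pred {set E}) : [disjoint F1 & F2] ->
  (forall S1 S2, S1 \subset F1 -> S2 \subset F2 ->
    P (S1 :|: S2) = P1 S1 && P2 S2) ->
  Z (F1 :|: F2) P = Z F1 P1 * Z F2 P2.
Proof.
move=> dF PP; rewrite /Z big_distrlr /= pair_big /=.
rewrite (reindex_onto (fun p : {set E} * {set E} => p.1 :|: p.2)
  (fun S => (S :&: F1, S :&: F2))) /=; last first.
  by move=> S /andP[/setIidPl sSF _]; rewrite -setIUr.
apply: eq_big => [[S1 S2] /= | [S1 S2] /= /andP[_ /eqP[<- <-]]]; last first.
  have [E1 E2] := setUI_disjoint dF (subsetIr (S1 :|: S2) F1) (subsetIr (S1 :|: S2) F2).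
  by rewrite weightU ?subsetIr.
apply/andP/andP => [[/andP[sSF PS] /eqP[E1 E2]] | [/andP[sS1 P1S] /andP[sS2 P2S]]].
  have sS1 : S1 \subset F1 by rewrite -E1 subsetIr.
  have sS2 : S2 \subset F2 by rewrite -E2 subsetIr.
  by rewrite sS1 sS2; apply/andP; rewrite -PP.
have [-> ->] := setUI_disjoint dF sS1 sS2; rewrite PP // P1S P2S eqxx.
by rewrite subUset !subsetU ?sS1 ?sS2 ?orbT.
Qed.

Lemma Z_set0 (P : pred {set E}) : P set0 -> Z set0 P = 1.
Proof.
move=> P0; rewrite /Z (big_pred1 set0) /weight ?setD0 ?cards0 ?mulr1 // => S.
by rewrite /= subset0; case: eqP => // ->.
Qed.

Lemma Z_set1 e (P : pred {set E}) :
  Z [set e] P = (if P set0 then q else 0) + (if P [set e] then 1 - q else 0).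
Proof.
have ne : set0 != [set e] by rewrite eq_sym -card_gt0 cards1.
rewrite /Z big_mkcondr /= (bigD1 set0) ?sub0set //= (big_pred1 [set e]) /weight.
  by rewrite setD0 setDv cards0 cards1 !expr0 !expr1 mulr1 mul1r.
move=> S; rewrite /= subset1.
by case: (eqVneq S set0) => [-> | _]; rewrite ?andbF ?orbF ?andbT // (negPf ne).
Qed.

(* [A], [A + B] and [B] of the header; [Zpair] is the reliability of the graph
   in which [s] and [t] are identified. *)
Definition Zconn F := Z F (fun S => spans (adj S) F).
Definition Zpair F s t := Z F (fun S => spans2 S F s t).
Definition Zsplit F s t := Z F (fun S => splits S F s t).

Lemma ZpairE F s t : connect (adj F) s t -> Zpair F s t = Zconn F + Zsplit F s t.
Proof. by move=> Fst; apply: Z_or => S _; apply: spans_and_splits. Qed.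

Lemma Zconn_glue F1 F2 m : [disjoint F1 & F2] ->
  verts F1 :&: verts F2 \subset [set m] -> Zconn (F1 :|: F2) = Zconn F1 * Zconn F2.
Proof. by move=> dF cap; apply: Z_disjointU => // S1 S2; apply: spans_glue cap. Qed.

Lemma Zsplit_series F1 F2 s m t : [disjoint F1 & F2] ->
  verts F1 :&: verts F2 = [set m] ->
  s \in verts F1 -> t \in verts F2 -> s != m -> t != m ->
  connect (adj F1) s m -> connect (adj F2) m t ->
  Zsplit (F1 :|: F2) s t = Zconn F1 * Zsplit F2 m t + Zsplit F1 s m * Zconn F2.
Proof.
move=> dF cap sV tV sm tm F1c F2c.
(* The two alternatives of [series_splits], read off the traces of [S]. They exclude each other
   because a trace cannot both span and split [F1]. *)
pose P1 S := spans (adj (S :&: F1)) F1 && splits (S :&: F2) F2 m t.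
pose P2 S := splits (S :&: F1) F1 s m && spans (adj (S :&: F2)) F2.
rewrite /Zsplit (@Z_or _ _ P1 P2) => [|S /setIidPl].
  by congr (_ + _); apply: Z_disjointU => // S1 S2 sS1 sS2;
     rewrite /P1 /P2; have [-> ->] := setUI_disjoint dF sS1 sS2.
rewrite setIUr => {1}<-; rewrite (series_splits cap) ?subsetIr //; split=> //.
rewrite /P1 /P2 andbACA negb_and.
by have [_ ->] := spans_and_splits (S :&: F1) F1c.
Qed.

Lemma Zpair_parallel F1 F2 s t : [disjoint F1 & F2] ->
  verts F1 :&: verts F2 = [set s; t] ->
  Zpair (F1 :|: F2) s t = Zpair F1 s t * Zpair F2 s t.
Proof. by move=> dF cap; apply: Z_disjointU => // S1 S2; apply: parallel_spans2. Qed.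

Lemma Zsplit_parallel F1 F2 s t : s != t -> [disjoint F1 & F2] ->
  verts F1 :&: verts F2 = [set s; t] ->
  Zsplit (F1 :|: F2) s t = Zsplit F1 s t * Zsplit F2 s t.
Proof.
by move=> st dF cap; apply: Z_disjointU => // S1 S2 ? ?; apply: parallel_splits.
Qed.

Lemma Zpair_edge e s t : ends e = (s, t) -> Zpair [set e] s t = 1.
Proof.
move=> est; have sp2 S : spans2 S [set e] s t.
  by apply/spansP => e' /set1P->; rewrite est connect_pair.
by rewrite /Zpair Z_set1 !sp2 addrC subrK.
Qed.

Lemma Zsplit_edge e s t : s != t -> ends e = (s, t) -> Zsplit [set e] s t = q.
Proof.
move=> st est; have sp2 S : spans2 S [set e] s t.
  by apply/spansP => e' /set1P->; rewrite est connect_pair.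
have n0 : ~~ connect (adj set0) s t.
  apply: contra st => /(connect_verts (subxx _))[/eqP //|/vertsP[e']].
  by rewrite inE.
have c1 : connect (adj [set e]) s t.
  by apply/connect1/adjP; exists e; rewrite ?set11 //; left.
by rewrite /Zsplit Z_set1 /splits !sp2 n0 c1 addr0.
Qed.

Lemma Zconn_loop e : (ends e).1 = (ends e).2 -> Zconn [set e] = 1.
Proof.
move=> loop; have sp1 S : spans (adj S) [set e].
  by apply/spansP => e' /set1P->; rewrite loop.
by rewrite /Zconn Z_set1 !sp1 addrC subrK.
Qed.

(** * Nonvanishing outside the closed unit disc *)

Hypothesis q_gt1 : 1 < `|q|.

(** The induction carries along with the bound the facts on terminals that the series and parallel
    formulas require. *)
Lemma sp_bound F s t : sp ends F s t ->
  [/\ s != t, s \in verts F, t \in verts F, connect (adj F) s t &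
      `|Zpair F s t| < `|Zsplit F s t| ].
Proof.
elim => {F s t} [e s t st est | F s t _ [st sV tV Fst lt] |
  F1 F2 s m t _ [sm sV mV1 F1c lt1] _ [mt mV2 tV F2c lt2] dF cap |
  F1 F2 s t _ [st sV tV F1c lt1] _ [_ _ _ F2c lt2] dF cap].
- split=> //.
  + by apply/vertsP; exists e; rewrite ?set11 // est; left.
  + by apply/vertsP; exists e; rewrite ?set11 // est; right.
  + by apply/connect1/adjP; exists e; rewrite ?set11 //; left.
  + by rewrite (Zpair_edge est) (Zsplit_edge st est) normr1.
- split=> //; first by rewrite eq_sym.
    by rewrite connect_adjC.
  rewrite /Zpair /Zsplit (eq_Z (fun S _ => spans2C S F t s)).
  by rewrite (eq_Z (fun S _ => splitsC S F t s)).
- have Fc : connect (adj (F1 :|: F2)) s t.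
    apply: connect_trans (connect_adjS (subsetUl _ _) F1c) _.
    exact: connect_adjS (subsetUr _ _) F2c.
  split=> //; rewrite ?vertsU ?in_setU ?sV ?tV ?orbT //.
    by apply: contraNneq sm => est; rewrite -in_set1 -cap inE sV est.
  rewrite ZpairE // (Zsplit_series dF cap) // 1?eq_sym // (Zconn_glue (m := m)) ?cap //.
  by apply: series_bound; rewrite -ZpairE.
- split=> //; rewrite ?vertsU ?in_setU ?sV ?tV //.
    exact: connect_adjS (subsetUl _ _) F1c.
  by rewrite (Zpair_parallel dF cap) (Zsplit_parallel st dF cap) !normrM ltr_pM.
Qed.

Lemma sp_Zconn_neq0 F s t : sp ends F s t -> Zconn F != 0.
Proof.
case/sp_bound => _ _ _ Fst; rewrite ZpairE //.
by apply: contraTneq => ->; rewrite add0r ltxx.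
Qed.

(** Induction on the number of edges, splitting [F] until it is empty or nonseparable. Maximality is
    taken relative to [F] so that the hypothesis passes to the parts. *)
Lemma blocks_Zconn_neq0 F :
  (forall B, nonsep ends B -> B \subset F ->
    (forall B', nonsep ends B' -> B' \subset F -> B \subset B' -> B' = B) ->
    exists s t, sp ends B s t) ->
  Zconn F != 0.
Proof.
have [n] := ubnP #|F|; elim: n F => // n IHn F ltFn spF.
have IHside F1 F2 m : F1 :|: F2 = F -> [disjoint F1 & F2] -> F2 != set0 ->
    verts F1 :&: verts F2 \subset [set m] -> Zconn F1 != 0.
  move=> F12 dF F2n cap; apply: IHn => [|B nsB sB maxB].
    rewrite ltnS in ltFn; apply: leq_trans ltFn.
    rewrite -F12 cardsU disjoint_setI0 // cards0 subn0 -[ltnLHS]addn0 ltn_add2l.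
    by rewrite card_gt0.
  apply: spF => // [|B' nsB' sB' sBB']; first by rewrite -F12 subsetU ?sB.
  (* A nonseparable [B'] containing [B] meets [F1], hence lies in [F1]: maximal sets of [F1] stay
     maximal in [F]. *)
  apply: maxB => //; rewrite -F12 in sB'; apply: (nonsep_side cap) nsB' sB' _.
  have [/set0Pn[e eB] _ _ _] := nsB; apply/set0Pn; exists e.
  by rewrite inE (subsetP sBB') ?(subsetP sB).
have [->|Fn] := eqVneq F set0.
  by rewrite /Zconn Z_set0 ?oner_eq0 //; apply/spansP => e; rewrite inE.
have [/exists_inP[e eF /eqP loop]|noloop] :=
    boolP [exists e in F, (ends e).1 == (ends e).2].
  (* [nonsep] excludes loops, so a loop is split off at its endpoint as a part of its own. *)
  have F12 : (F :\ e) :|: [set e] = F by rewrite setUC setD1K.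
  have dF : [disjoint F :\ e & [set e]].
    by rewrite disjoint_sym disjoints1 in_setD1 eqxx.
  have cap : verts (F :\ e) :&: verts [set e] \subset [set (ends e).1].
    apply/subsetP => v /setIP[_ /vertsP[e' /set1P->]].
    by rewrite -loop => -[] ->; rewrite set11.
  rewrite -F12 (Zconn_glue dF cap) Zconn_loop // mulr1.
  by apply: (IHside _ _ _ F12 dF _ cap); rewrite -card_gt0 cards1.
have {}noloop e : e \in F -> (ends e).1 != (ends e).2.
  by move=> eF; apply: contraNN noloop => loop; apply/exists_inP; exists e.
have [nsF | [F1 [F2 [m [F12 dF n1 n2 cap]]]]] := nonsep_or_split Fn noloop.
  have [|s [t /sp_Zconn_neq0 //]] := spF F nsF (subxx _).
  by move=> B' _ sB'F sFB'; apply/eqP; rewrite eqEsubset sB'F.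
rewrite -F12 (Zconn_glue dF cap) mulf_neq0 //; first exact: IHside F12 dF n2 cap.
apply: (IHside F2 F1 m) => //; [by rewrite setUC | by rewrite disjoint_sym |].
by rewrite setIC.
Qed.

End Weight.

(** * Evaluation of the reliability polynomial and conclusion *)

Lemma inducedFT F : inducedF ends [set: V] F = F.
Proof. by apply/setP => e; rewrite !inE !andbT. Qed.

(** In a connected graph, [S] joins all pairs of vertices as soon as it joins the endpoints of every
    edge. *)
Lemma reliability_Zconn (C : numClosedFieldType) (q : C) :
  spanning_connected ends [set: E] -> (reliability ends C).[q] = Zconn q [set: E].
Proof.
move=> /conn_onP Gconn; rewrite /reliability horner_sum; apply: eq_big => [S | S _].
  rewrite subsetT /=; apply/conn_onP/spansP => [Sconn e _ | Ssp x y xV yV].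
    by have := Sconn (ends e).1 (ends e).2; rewrite inducedFT; apply; rewrite inE.
  have := Gconn x y xV yV; rewrite !inducedFT; apply: spans_connect.
    exact: adj_sym.
  by apply/spansP => e eT; apply: Ssp.
by rewrite hornerM !horner_exp !hornerE /weight setTD.
Qed.

End Multigraph.

Theorem theorem0p2 (R : realType) (V E : finType) (ends : E -> V * V) :
  in_SP' ends ->
  forall q : R[i], (reliability ends R[i]).[q] = 0 -> `|q| <= 1.
Proof.
move=> [Gconn Gsp] q; rewrite reliability_Zconn // => /eqP Zq0.
rewrite real_leNgt ?normr_real ?real1 //; apply: contraL Zq0 => q_gt1.
apply: blocks_Zconn_neq0 => // B nsB _ maxB; apply: Gsp; split=> // B' nsB' sBB'.
by apply: maxB => //; apply: subsetT.
Qed.
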